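(* Let $A,P\in\mathbb{R}^{n\times n}$ be invertible, $b\in\mathbb{R}^n$, and consider AA($m$) used to accelerate the preconditioned Richardson iteration $q(x)=x+P(b-Ax)$ for solving $Ax=b$. Let $B=I-PA$ and $r_{k}=x_{k}-q(x_{k})$. Assume that $B$ is invertible. Then for every $k\ge0$ the least-squares problem defining $\boldsymbol{\alpha}^{(k)}$ can be rewritten as $$\min_{\boldsymbol{\alpha}^{(k)}}\|r_k-R_k\boldsymbol{\alpha}^{(k)}\|^2=\min_{\boldsymbol{\alpha}^{(k)}}\|B^{-1}r_{k+1}\|^2,$$ i.e. for every coefficient vector $\boldsymbol{\alpha}^{(k)}$ its objective equals $\|r_k-R_k\boldsymbol{\alpha}^{(k)}\|^2$ and equals $\|B^{-1}r_{k+1}\|^2$ (with $x_{k+1}$, hence $r_{k+1}$, regarded as a function of $\boldsymbol{\alpha}^{(k)}$), where $$R_k=[\,r_{k-1}-r_k,\ r_{k-2}-r_k,\ \dots,\ r_{k-m_k}-r_k\,].$$ In addition, for the iterates generated by AA($m$), for all $k\ge0$, $$\|B^{-1}r_{k+1}\|\le\|r_k\|,$$ and for all $i,j=0,1,\dots,m_k$, $$(B^{-1}r_{k+1})^T(r_{k-i}-r_{k-j})=0.$$ Furthermore, if $\|B\|<1$, then $\|r_{k+1}\|<\|r_k\|$ for every $k$ with $r_k\ne0$.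
   Context: $\|\cdot\|$ is the 2-norm for vectors and matrices, and $r(x)=x-q(x)=P(Ax-b)$ is the preconditioned residual, so $r_k=r(x_k)$. AA($m$) (Anderson acceleration with depth $m$), $m\ge0$ an integer: given $x_0\in\mathbb{R}^n$, for $k=0,1,2,\dots$ let $m_k=\min\{k,m\}$ and set $$x_{k+1}=q(x_k)+\sum_{i=1}^{m_k}\alpha_i^{(k)}\big(q(x_k)-q(x_{k-i})\big),$$ where $\boldsymbol{\alpha}^{(k)}=(\alpha_1^{(k)},\dots,\alpha_{m_k}^{(k)})\in\mathbb{R}^{m_k}$ is obtained by solving the least-squares problem $$\min_{\boldsymbol{\alpha}^{(k)}}\Big\|r(x_k)+\sum_{i=1}^{m_k}\alpha_i^{(k)}\big(r(x_k)-r(x_{k-i})\big)\Big\|^2 .$$ When $m_k=0$ the sums are empty. *)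

(* Defs.v *)
From HB Require Import structures.
From mathcomp Require Export all_boot all_order all_algebra.
From mathcomp Require Export classical_sets reals.

Set Implicit Arguments.
Unset Strict Implicit.
Unset Printing Implicit Defensive.
Import Order.TTheory GRing.Theory Num.Theory.
Local Open Scope classical_set_scope.
Local Open Scope ring_scope.

(* The norm that MathComp-Analysis puts on matrices is the max norm, hence the
   explicit 2-norm. *)
Definition l2norm (R : realType) (n : nat) (v : 'cV[R]_n) : R :=
  Num.sqrt (\sum_(i < n) v i 0 ^+ 2).

(* The closed unit ball, rather than the unit sphere, keeps the set nonempty
   when n = 0. *)
Definition mx2norm (R : realType) (n : nat) (M : 'M[R]_n) : R :=
  sup [set l2norm (M *m v) | v in [set v : 'cV[R]_n | l2norm v <= 1]].

Definition richardson (R : realType) (n : nat) (A P : 'M[R]_n) (b : 'cV[R]_n)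
    (x : 'cV[R]_n) : 'cV[R]_n :=
  x + P *m (b - A *m x).

Definition residual (R : realType) (n : nat) (q : 'cV[R]_n -> 'cV[R]_n)
    (x : 'cV[R]_n) : 'cV[R]_n :=
  x - q x.

(* The ordinal i : 'I_(minn k m) stands for the index i + 1 in {1, ..., m_k}.
   The coefficient vector a is a free argument, and only x 0, ..., x k are
   used. *)
Definition AA_step (R : realType) (n m : nat) (q : 'cV[R]_n -> 'cV[R]_n)
    (x : nat -> 'cV[R]_n) (k : nat) (a : 'cV[R]_(minn k m)) : 'cV[R]_n :=
  q (x k) + \sum_(i < minn k m) a i 0 *: (q (x k) - q (x (k - i.+1)%N)).

Definition AA_objective (R : realType) (n m : nat) (q : 'cV[R]_n -> 'cV[R]_n)
    (x : nat -> 'cV[R]_n) (k : nat) (a : 'cV[R]_(minn k m)) : R :=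
  l2norm (residual q (x k) +
          \sum_(i < minn k m)
            a i 0 *: (residual q (x k) - residual q (x (k - i.+1)%N))) ^+ 2.

(* The least-squares problem may have several solutions, so AA(m) is a relation:
   alpha k is any minimizer. The initial guess x 0 is unconstrained. *)
Definition AA_iterates (R : realType) (n m : nat) (q : 'cV[R]_n -> 'cV[R]_n)
    (x : nat -> 'cV[R]_n) (alpha : forall k, 'cV[R]_(minn k m)) : Prop :=
  forall k,
    (forall a : 'cV[R]_(minn k m),
       AA_objective q x (alpha k) <= AA_objective q x a) /\
    x k.+1 = AA_step q x (alpha k).

(* Column j (counted from 0) is r_{k-(j+1)} - r_k. *)
Definition AA_Rmx (R : realType) (n m : nat) (r : nat -> 'cV[R]_n) (k : nat) :
    'M[R]_(n, minn k m) :=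
  \matrix_(i < n, j < minn k m) (r (k - j.+1)%N - r k) i 0.

(* Main.v *)
Require Import Defs.
From mathcomp Require Import all_boot all_order all_algebra.
From mathcomp Require Import classical_sets reals.
From mathcomp Require Import ring.
Import Order.TTheory GRing.Theory Num.Theory.
Local Open Scope ring_scope.

(** The preconditioned residual is affine with linear part [P *m A], and the
Richardson map [q] multiplies it by [B = 1 - P *m A].  The coefficients of
[q (x k)], ..., [q (x (k - m_k))] in an Anderson step add up to 1, so affinity
carries over to the whole step: the residual of [AA_step q x a] is [B] applied
to [r k - R_k *m a], the same combination of the previous residuals
([residual_AA_step]).  Hence [invmx B] turns the next residual back into the
very vector whose norm the least-squares problem minimizes, which is the
reformulation of that problem.

Everything else is read off from this.  The value at the minimizer is at most
the value at [a = 0], which is [l2norm (r k)].  The minimal vector satisfies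
the normal equations ([least_squares_orthogonal]), that is, it is orthogonal to
the column space of [R_k], and every difference [r (k - i) - r (k - j)] lies in
that space ([residual_diff_in_range]).  Finally [r k.+1] is [B] times a vector
no longer than [r k], so [mx2norm B < 1] makes it strictly shorter; this uses
that the supremum defining [mx2norm] is a supremum of a bounded set
([l2norm_mulmx]). *)

(** * The Euclidean norm and the induced matrix norm *)

Lemma sqr_l2norm {R : realType} {n : nat} (v : 'cV[R]_n) :
  l2norm v ^+ 2 = \sum_(i < n) v i 0 ^+ 2.
Proof. by rewrite sqr_sqrtr // sumr_ge0 // => i _; exact: sqr_ge0. Qed.

Lemma l2norm_ge0 {R : realType} {n : nat} (v : 'cV[R]_n) : 0 <= l2norm v.
Proof. exact: sqrtr_ge0. Qed.

Lemma l2norm0 (R : realType) (n : nat) : l2norm (0 : 'cV[R]_n) = 0.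
Proof.
by apply/eqP; rewrite -sqrf_eq0 sqr_l2norm big1 // => i _; rewrite mxE expr0n.
Qed.

Lemma l2normZ {R : realType} {n : nat} (c : R) (v : 'cV[R]_n) :
  l2norm (c *: v) = `|c| * l2norm v.
Proof.
apply/eqP; rewrite -(eqrXn2 (n := 2)) ?mulr_ge0 ?l2norm_ge0 //.
rewrite exprMn !sqr_l2norm real_normK ?num_real // mulr_sumr.
by apply/eqP/eq_bigr => i _; rewrite mxE exprMn.
Qed.

Lemma l2norm_eq0 {R : realType} {n : nat} (v : 'cV[R]_n) :
  l2norm v = 0 -> v = 0.
Proof.
move=> v0; have /eqP := sqr_l2norm v.
rewrite v0 expr0n eq_sym psumr_eq0 => [/allP v_eq0|i _]; last exact: sqr_ge0.
apply/matrixP => i j; rewrite (ord1 j) mxE; apply/eqP; rewrite -sqrf_eq0.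
exact: v_eq0 (mem_index_enum i).
Qed.

Lemma l2norm_gt0 {R : realType} {n : nat} (v : 'cV[R]_n) :
  v <> 0 -> 0 < l2norm v.
Proof.
by move=> v0; rewrite lt0r l2norm_ge0 andbT; apply/eqP => /l2norm_eq0.
Qed.

Lemma sqr_l2normB {R : realType} {n : nat} (v w : 'cV[R]_n) (t : R) :
  l2norm (v - t *: w) ^+ 2 =
    l2norm v ^+ 2 - t * (v^T *m w) 0 0 *+ 2 + t ^+ 2 * l2norm w ^+ 2.
Proof.
rewrite !sqr_l2norm mxE !mulr_sumr -sumrMnl -sumrN -!big_split /=.
by apply: eq_bigr => i _; rewrite !mxE; ring.
Qed.

Lemma norm_coord_le_l2norm {R : realType} {n : nat} (v : 'cV[R]_n) (i : 'I_n) :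
  `|v i 0| <= l2norm v.
Proof.
rewrite -sqrtr_sqr ler_wsqrtr // (bigD1 i) //= lerDl sumr_ge0 // => j _.
exact: sqr_ge0.
Qed.

(** On the unit ball every coordinate is at most 1 in absolute value, so the
absolute row sums of [M] bound the coordinates of [M *m v].  The bound is far
from sharp, but all that matters is that it does not depend on [v]. *)
Lemma l2norm_mulmx_row_sums {R : realType} {n : nat} (M : 'M[R]_n)
    (v : 'cV[R]_n) :
  l2norm v <= 1 ->
  l2norm (M *m v) <= Num.sqrt (\sum_i (\sum_j `|M i j|) ^+ 2).
Proof.
move=> v_le1; apply/ler_wsqrtr/ler_sum => i _.
rewrite -real_normK ?num_real // ler_sqr ?nnegrE ?sumr_ge0 //.
rewrite mxE; apply: le_trans (ler_norm_sum _ _ _) _; apply: ler_sum => j _.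
rewrite normrM ler_piMr //.
exact: le_trans (norm_coord_le_l2norm v j) v_le1.
Qed.

(** On an unbounded set [sup] returns a default value, so [mx2norm] bounds the
action of [M] only because of [l2norm_mulmx_row_sums]. *)
Lemma l2norm_mulmx {R : realType} {n : nat} (M : 'M[R]_n) (v : 'cV[R]_n) :
  l2norm (M *m v) <= mx2norm M * l2norm v.
Proof.
have [->|/eqP v_neq0] := eqVneq v 0; first by rewrite mulmx0 !l2norm0 mulr0.
have v_gt0 := l2norm_gt0 v v_neq0.
rewrite -ler_pdivrMr // mulrC.
have <- : l2norm (M *m ((l2norm v)^-1 *: v)) = (l2norm v)^-1 * l2norm (M *m v).
  by rewrite -scalemxAr l2normZ ger0_norm // invr_ge0 ltW.
apply: ub_le_sup.
  exists (Num.sqrt (\sum_i (\sum_j `|M i j|) ^+ 2)) => _ [w w_le1 <-].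
  exact: l2norm_mulmx_row_sums.
exists ((l2norm v)^-1 *: v) => //=.
by rewrite l2normZ ger0_norm ?invr_ge0 ?l2norm_ge0 // mulVf // gt_eqF.
Qed.

Lemma l2norm_mulmx_lt {R : realType} {n : nat} (M : 'M[R]_n) (v : 'cV[R]_n) :
  mx2norm M < 1 -> v <> 0 -> l2norm (M *m v) < l2norm v.
Proof.
move=> M_lt1 v_neq0; apply: le_lt_trans (l2norm_mulmx M v) _.
by rewrite gtr_pMl // l2norm_gt0.
Qed.

(** * Least squares *)

(** The squared distance from [v] to [t *: w] is a quadratic function of [t]
whose slope at [t = 0] is a multiple of the inner product; a minimum at 0 makes
that slope vanish. *)
Lemma orthogonal_of_min {R : realType} {n : nat} (v w : 'cV[R]_n) :
  (forall t : R, l2norm v ^+ 2 <= l2norm (v - t *: w) ^+ 2) -> v^T *m w = 0.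
Proof.
move=> v_min; apply/matrixP => i j; rewrite !ord1 [RHS]mxE.
set d := (_ *m _) 0 0; set c := l2norm w ^+ 2.
have c1_gt0 : 0 < c + 1 by rewrite ltr_wpDl // sqr_ge0.
(* The quadratic is smallest at t = d / c, but c may be 0; the smaller step
   d / (c + 1) is always defined and still decreases it unless d = 0. *)
have := v_min (d / (c + 1)); rewrite sqr_l2normB -/d -/c -addrA lerDl.
have -> : - (d / (c + 1) * d *+ 2) + (d / (c + 1)) ^+ 2 * c =
    - ((d / (c + 1)) ^+ 2 * (c + 2)).
  by field; rewrite gt_eqF.
rewrite oppr_ge0 pmulr_lle0 ?(lt_trans c1_gt0) ?ltrD2l ?ltr1n //.
move=> d2_le0; have /eqP : (d / (c + 1)) ^+ 2 = 0.
  by apply/eqP; rewrite eq_le d2_le0 sqr_ge0.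
by rewrite sqrf_eq0 mulf_eq0 invr_eq0 (gt_eqF c1_gt0) orbF => /eqP.
Qed.

(** The normal equations: moving the coefficients from [s] towards [s + c]
moves the residual along the line spanned by [M *m c]. *)
Lemma least_squares_orthogonal {R : realType} {n p : nat} (M : 'M[R]_(n, p))
    (u : 'cV[R]_n) (s : 'cV[R]_p) :
  (forall a, l2norm (u - M *m s) ^+ 2 <= l2norm (u - M *m a) ^+ 2) ->
  forall c : 'cV[R]_p, (u - M *m s)^T *m (M *m c) = 0.
Proof.
move=> s_min c; apply: orthogonal_of_min => t.
have -> : u - M *m s - t *: (M *m c) = u - M *m (s + t *: c).
  by rewrite mulmxDr -scalemxAr opprD addrA.
exact: s_min.
Qed.

(** * Residuals of the Anderson step *)

Lemma residual_richardson {R : realType} {n : nat} (A P : 'M[R]_n)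
    (b y : 'cV[R]_n) :
  residual (richardson A P b) y = P *m (A *m y - b).
Proof. by rewrite /residual /richardson opprD addNKr -mulmxN opprB. Qed.

Lemma residual_map_richardson {R : realType} {n : nat} (A P : 'M[R]_n)
    (b y : 'cV[R]_n) :
  residual (richardson A P b) (richardson A P b y) =
    (1%:M - P *m A) *m residual (richardson A P b) y.
Proof.
rewrite !residual_richardson mulmxBl mul1mx /richardson.
rewrite -[b - _]opprB mulmxN; set e := A *m y - b.
by rewrite [A *m (y - _)]mulmxBr addrAC -/e mulmxBr -mulmxA.
Qed.

(** Affinity alone: the weights [a i 0] multiply differences, on which the
constant part of the residual cancels. *)
Lemma residual_richardson_comb {R : realType} {n p : nat} (A P : 'M[R]_n)
    (b y : 'cV[R]_n) (z w : 'I_p -> 'cV[R]_n) (a : 'cV[R]_p) :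
  residual (richardson A P b) (y + \sum_i a i 0 *: (z i - w i)) =
    residual (richardson A P b) y +
    \sum_i a i 0 *: (residual (richardson A P b) (z i) -
                     residual (richardson A P b) (w i)).
Proof.
rewrite !residual_richardson [A *m (y + _)]mulmxDr addrAC [LHS]mulmxDr.
congr (_ + _).
rewrite !mulmx_sumr; apply: eq_bigr => i _.
rewrite -!scalemxAr !residual_richardson -[in RHS]mulmxBr.
by congr (_ *: (_ *m _)); rewrite mulmxBr opprB addrA subrK.
Qed.

Lemma mulmx_AA_Rmx {R : realType} {n : nat} (m : nat) (r : nat -> 'cV[R]_n)
    (k : nat) (a : 'cV[R]_(minn k m)) :
  AA_Rmx m r k *m a = \sum_(i < minn k m) a i 0 *: (r (k - i.+1)%N - r k).
Proof.
apply/matrixP => i j; rewrite ord1 summxE !mxE.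
by apply: eq_bigr => l _; rewrite !mxE mulrC.
Qed.

Lemma sub_mulmx_AA_Rmx {R : realType} {n : nat} (m : nat) (r : nat -> 'cV[R]_n)
    (k : nat) (a : 'cV[R]_(minn k m)) :
  r k - AA_Rmx m r k *m a =
    r k + \sum_(i < minn k m) a i 0 *: (r k - r (k - i.+1)%N).
Proof.
rewrite mulmx_AA_Rmx -sumrN; congr (_ + _); apply: eq_bigr => i _.
by rewrite -scalerN opprB.
Qed.

Lemma residual_AA_step {R : realType} {n m : nat} (A P : 'M[R]_n)
    (b : 'cV[R]_n) (x : nat -> 'cV[R]_n) (k : nat) (a : 'cV[R]_(minn k m)) :
  let q := richardson A P b in
  let r := fun k : nat => residual q (x k) in
  residual q (AA_step q x a) =
    (1%:M - P *m A) *m (r k - AA_Rmx m r k *m a).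
Proof.
move=> q r; rewrite residual_richardson_comb sub_mulmx_AA_Rmx.
rewrite mulmxDr residual_map_richardson mulmx_sumr; congr (_ + _).
apply: eq_bigr => i _; rewrite -scalemxAr.
by rewrite !residual_map_richardson -mulmxBr.
Qed.

(** The [i]-th residual for [i > 0] enters through the column with index
[i.-1]; for [i = 0] the difference is 0. *)
Lemma residual_in_range {R : realType} {n : nat} (m : nat)
    (r : nat -> 'cV[R]_n) (k i : nat) :
  (i <= minn k m)%N -> exists c, r (k - i)%N - r k = AA_Rmx m r k *m c.
Proof.
case: i => [_|i i_lt]; first by exists 0; rewrite subn0 subrr mulmx0.
exists (delta_mx (Ordinal i_lt) 0).
by rewrite -colE; apply/matrixP => l j; rewrite ord1 !mxE.
Qed.

Lemma residual_diff_in_range {R : realType} {n : nat} (m : nat)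
    (r : nat -> 'cV[R]_n) (k i j : nat) :
  (i <= minn k m)%N -> (j <= minn k m)%N ->
  exists c, r (k - i)%N - r (k - j)%N = AA_Rmx m r k *m c.
Proof.
move=> /(residual_in_range m r k i)[c rc] /(residual_in_range m r k j)[d rd].
by exists (c - d); rewrite mulmxBr -rc -rd opprB addrA subrK.
Qed.

(** * Convergence of Anderson acceleration *)

Theorem theorem2p1 (R : realType) (n m : nat) (A P : 'M[R]_n) (b : 'cV[R]_n)
    (x : nat -> 'cV[R]_n) (alpha : forall k : nat, 'cV[R]_(minn k m)) :
  let q := richardson A P b in
  let B := 1%:M - P *m A in
  let r := fun k : nat => residual q (x k) in
  A \in unitmx -> P \in unitmx -> B \in unitmx ->
  AA_iterates q x alpha ->
  [/\ forall (k : nat) (a : 'cV[R]_(minn k m)),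
        AA_objective q x a = l2norm (r k - AA_Rmx m r k *m a) ^+ 2 /\
        AA_objective q x a =
          l2norm (invmx B *m residual q (AA_step q x a)) ^+ 2,
      forall k : nat, l2norm (invmx B *m r k.+1) <= l2norm (r k),
      forall k i j : nat, (i <= minn k m)%N -> (j <= minn k m)%N ->
        (invmx B *m r k.+1)^T *m (r (k - i)%N - r (k - j)%N) = 0
    & mx2norm B < 1 ->
        forall k : nat, r k <> 0 -> l2norm (r k.+1) < l2norm (r k)].

Proof.
move=> q B r _ _ unitB iter_x.
have obj_def k (a : 'cV[R]_(minn k m)) :
    AA_objective q x a = l2norm (r k - AA_Rmx m r k *m a) ^+ 2.
  by rewrite sub_mulmx_AA_Rmx.
have step_res k (a : 'cV[R]_(minn k m)) :
    invmx B *m residual q (AA_step q x a) = r k - AA_Rmx m r k *m a.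
  by rewrite residual_AA_step mulKmx.
have next_res k : invmx B *m r k.+1 = r k - AA_Rmx m r k *m alpha k.
  by rewrite -step_res /r (iter_x k).2.
have alpha_min k (a : 'cV[R]_(minn k m)) :
    l2norm (r k - AA_Rmx m r k *m alpha k) ^+ 2 <=
    l2norm (r k - AA_Rmx m r k *m a) ^+ 2.
  by rewrite -!obj_def; exact: (iter_x k).1.
have next_le k : l2norm (invmx B *m r k.+1) <= l2norm (r k).
  rewrite -ler_sqr ?nnegrE ?l2norm_ge0 // next_res.
  by have := alpha_min k 0; rewrite mulmx0 subr0.
split=> //.
- by move=> k a; rewrite step_res obj_def.
- move=> k i j i_le j_le; rewrite next_res.
  have [c ->] := residual_diff_in_range m r k i j i_le j_le.
  exact: least_squares_orthogonal.
- move=> B_lt1 k rk_neq0.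
  have [Br0|/eqP Br_neq0] := eqVneq (invmx B *m r k.+1) 0.
    by rewrite -[r k.+1](mulKVmx unitB) Br0 mulmx0 l2norm0 l2norm_gt0.
  rewrite -[r k.+1](mulKVmx unitB).
  exact: lt_le_trans (l2norm_mulmx_lt _ _ B_lt1 Br_neq0) (next_le k).
Qed.
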